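(* Let $\Pi$ be a partition of $[n]$ with at least two blocks and no blocks of size $1$. Then for all integers $i\ge 2$, \[ \mathrm{Comp}_{n+i}(\mathrm{Aut}\,\Pi) = \begin{cases} S_{\Pi^{(i)}}, & \text{if } \delta_n\notin\mathrm{Aut}\,\Pi \text{ and } \zeta_n\notin\mathrm{Aut}\,\Pi,\\ \langle S_{\Pi^{(i)}},\delta_{n+i}\rangle, & \text{if } \delta_n\in\mathrm{Aut}\,\Pi\text{ and }\zeta_n\notin\mathrm{Aut}\,\Pi,\\ D_{n+i}, & \text{if }\zeta_n\in\mathrm{Aut}\,\Pi.\end{cases} \]
   Context: $S_n$ is the symmetric group on $[n]=\{1,\dots,n\}$ (composition right to left); $\delta_n$ is $i\mapsto n+1-i$; $\zeta_n=(1\,2\,\cdots\,n)$; $D_n=\langle \zeta_n,\delta_n\rangle$. For a partition $\Pi$ of $[n]$, $\mathrm{Aut}\,\Pi=\{\pi\in S_n:\pi(B)\in\Pi\text{ for all }B\in\Pi\}$ and $S_\Pi=\{\pi\in S_n:\pi(B)=B\text{ for all }B\in\Pi\}$. Let $\widehat{\Pi}$ be the coarsest partition of $[n]$ into intervals refining $\Pi$, with blocks $[1]_{\widehat\Pi}\ni1$, $[n]_{\widehat\Pi}\ni n$; define partitions of $[n+1]$: $\widehat\Pi^{1}=\{B+1 : B\in\widehat\Pi,\,1\notin B\}\cup\{([1]_{\widehat\Pi}+1)\cup\{1\}\}$ and $\widehat\Pi^{n+1}=\{B: B\in\widehat\Pi,\, n\notin B\}\cup\{[n]_{\widehat\Pi}\cup\{n+1\}\}$;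 $\Pi'$ is their coarsest common refinement; $\Pi^{(1)}=\Pi'$, $\Pi^{(i+1)}=(\Pi^{(i)})'$. A permutation $\pi\in S_m$ involves $\tau\in S_n$ ($n\le m$) if there are indices $i_1<\dots<i_n$ with $\pi(i_j)<\pi(i_k)$ iff $\tau(j)<\tau(k)$ for all $j,k$; such $\tau$ is an $n$-pattern of $\pi$. For $S\subseteq S_n$, $\mathrm{Comp}_m(S)$ is the set of $\tau\in S_m$ all of whose $n$-patterns belong to $S$. *)

(* Defs.v *)
From mathcomp Require Import all_boot all_fingroup.
Set Implicit Arguments.
Unset Strict Implicit.
Unset Printing Implicit Defensive.

(* [n] = {1, ..., n} is 'I_n, with k in [n] represented by the ordinal of value
   k - 1.  Products in 'S_n compose left to right; this has no effect on which
   sets are subgroups, nor on the subgroup generated by a set. *)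

Section Partitions.
Variable T : finType.
Implicit Types (P Q R : {set {set T}}) (p : pred {set {set T}}).

Definition refines Q P : bool :=
  [forall B in Q, exists C in P, B \subset C].

Definition is_coarsest p Q : bool :=
  [&& partition Q [set: T], p Q &
      [forall R, partition R [set: T] && p R ==> refines R Q]].

(* The default set0 is not reached in the two uses below, by
   interval_refinementP, common_refinementP and partition_derived. *)
Definition coarsest p : {set {set T}} := odflt set0 [pick Q | is_coarsest p Q].

Definition common_refinement P Q : {set {set T}} :=
  coarsest [pred R | refines R P && refines R Q].

End Partitions.

Definition is_interval n (B : {set 'I_n}) : bool :=
  [forall i in B, forall j in B, forall k : 'I_n, (i <= k <= j) ==> (k \in B)].

Definition interval_refinement n (P : {set {set 'I_n}}) : {set {set 'I_n}} :=
  coarsest [pred Q | refines Q P && [forall B in Q, is_interval B]].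

Definition has_val n (k : nat) (B : {set 'I_n}) : bool :=
  [exists i in B, i == k :> nat].

(* lift x is the increasing bijection from 'I_n to 'I_n.+1 minus x; the point x
   joins the image of the block of Q containing the ordinal of value k. *)
Definition extend n (x : 'I_n.+1) (k : nat) (Q : {set {set 'I_n}}) :
    {set {set 'I_n.+1}} :=
  [set lift x @: B | B : {set 'I_n} in Q & ~~ has_val k B]
  :|: [set x |: lift x @: B | B : {set 'I_n} in Q & has_val k B].

(* lift ord0 is the shift j |-> j + 1. *)
Definition extend_first n (Q : {set {set 'I_n}}) := extend ord0 0 Q.

(* lift ord_max preserves values. *)
Definition extend_last n (Q : {set {set 'I_n}}) := extend ord_max n.-1 Q.

Definition derived n (P : {set {set 'I_n}}) : {set {set 'I_n.+1}} :=
  common_refinement (extend_first (interval_refinement P))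
                    (extend_last (interval_refinement P)).

(* The ground set is written 'I_(i + n) rather than 'I_(n + i) because
   i.+1 + n is convertible to (i + n).+1. *)
Fixpoint iter_derived n (P : {set {set 'I_n}}) (i : nat) : {set {set 'I_(i + n)}} :=
  if i is j.+1 then derived (iter_derived P j) else P.

Definition partition_aut n (P : {set {set 'I_n}}) : {set 'S_n} :=
  [set s : 'S_n | [forall B in P, s @: B \in P]].

Definition partition_stab n (P : {set {set 'I_n}}) : {set 'S_n} :=
  [set s : 'S_n | [forall B in P, s @: B == B]].

Definition delta n : 'S_n := perm (@rev_ord_inj n).

Definition zeta n : 'S_n := perm (@ordS_inj n).

Definition dihedral n : {set 'S_n} := <<[set zeta n; delta n]>>%g.

Definition involves m n (s : 'S_m) (t : 'S_n) : bool :=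
  [exists f : {ffun 'I_n -> 'I_m},
    [forall j : 'I_n, forall k : 'I_n, (j < k) ==> (f j < f k)]
    && [forall j : 'I_n, forall k : 'I_n, (s (f j) < s (f k)) == (t j < t k)]].

Definition Comp n m (S : {set 'S_n}) : {set 'S_m} :=
  [set t : 'S_m | [forall u : 'S_n, involves t u ==> (u \in S)]].

Section Facts.
Variable T : finType.
Implicit Types (P Q R : {set {set T}}) (p : pred {set {set T}}).

Lemma refines_anti P Q :
  partition P [set: T] -> partition Q [set: T] ->
  refines P Q -> refines Q P -> P = Q.
Proof.
have aux A B : partition A [set: T] ->
    refines A B -> refines B A -> A \subset B.
  case/and3P=> _ triA nA0 AB BA; apply/subsetP => X XA.
  have /exists_inP[Y YB XY] := forall_inP AB X XA.
  have /exists_inP[Z ZA YZ] := forall_inP BA Y YB.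
  have [x xX] : exists x, x \in X.
    by apply/set0Pn; apply: contraNneq nA0 => <-.
  have XZ : X = Z.
    have xZ : x \in Z by apply: (subsetP YZ); apply: (subsetP XY).
    by rewrite -(def_pblock triA XA xX) (def_pblock triA ZA xZ).
  by have -> : X = Y by apply/eqP; rewrite eqEsubset XY XZ.
move=> pP pQ PQ QP; apply/eqP.
by rewrite eqEsubset (aux _ _ pP PQ QP) (aux _ _ pQ QP PQ).
Qed.

Lemma coarsest_eq p Q : is_coarsest p Q -> coarsest p = Q.
Proof.
move=> cQ; rewrite /coarsest; case: pickP => [R cR|/(_ Q)]; last by rewrite cQ.
case/and3P: cQ => pQ hQ maxQ; case/and3P: cR => pR hR maxR /=.
apply: refines_anti => //.
  by have := forallP maxQ R; rewrite pR hR.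
by have := forallP maxR Q; rewrite pQ hQ.
Qed.

Lemma is_coarsest_equivalence p (r : rel T) :
  equivalence_rel r ->
  p (equivalence_partition r [set: T]) ->
  (forall R B x y, partition R [set: T] -> p R -> B \in R ->
     x \in B -> y \in B -> r x y) ->
  is_coarsest p (equivalence_partition r [set: T]).
Proof.
move=> er pE sub; have er' : {in [set: T] & &, equivalence_rel r}.
  by move=> x y z _ _ _; apply: er.
have parE := equivalence_partitionP er'.
rewrite /is_coarsest parE pE; apply/forallP => R; apply/implyP => /andP[parR pR].
apply/forall_inP => B BR; have [x xB] : exists x, x \in B.
  apply/set0Pn; case/and3P: parR => _ _ nR0.
  by apply: contraNneq nR0 => <-.
apply/exists_inP; exists (pblock (equivalence_partition r [set: T]) x).
  by rewrite pblock_mem // (cover_partition parE) inE.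
apply/subsetP => y yB; rewrite pblock_equivalence_partition ?inE //.
exact: sub pR BR xB yB.
Qed.

Lemma same_block P x y B : partition P [set: T] -> B \in P ->
  x \in B -> y \in B -> pblock P x = pblock P y.
Proof.
case/and3P=> _ triP _ BP xB yB.
by rewrite (def_pblock triP BP xB) (def_pblock triP BP yB).
Qed.

Lemma same_block_refines R P x y B : partition P [set: T] -> refines R P ->
  B \in R -> x \in B -> y \in B -> pblock P x = pblock P y.
Proof.
move=> parP RP BR xB yB; have /exists_inP[C CP BC] := forall_inP RP B BR.
by apply: (same_block parP CP); apply: (subsetP BC).
Qed.

Lemma equivalence_partition_memP (r : rel T) B :
  equivalence_rel r -> B \in equivalence_partition r [set: T] ->
  exists x, B = [set y | r x y].
Proof.
move=> er /imsetP[x _ ->]; exists x.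
by apply/setP => y; rewrite !inE.
Qed.

Lemma refines_equivalence (r : rel T) P :
  equivalence_rel r -> partition P [set: T] ->
  (forall x y, r x y -> pblock P x = pblock P y) ->
  refines (equivalence_partition r [set: T]) P.
Proof.
move=> er parP rP; apply/forall_inP => B /(equivalence_partition_memP er)[x ->].
have cP y : y \in cover P by rewrite (cover_partition parP) inE.
apply/exists_inP; exists (pblock P x); first by rewrite pblock_mem.
by apply/subsetP => y; rewrite inE => /rP ->; rewrite mem_pblock.
Qed.

Lemma common_refinementP P Q :
  partition P [set: T] -> partition Q [set: T] ->
  is_coarsest [pred R | refines R P && refines R Q] (common_refinement P Q).
Proof.
move=> parP parQ.
pose r := [rel x y | (pblock P x == pblock P y) && (pblock Q x == pblock Q y)].
have er : equivalence_rel r.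
  move=> x y z /=; split; first by rewrite !eqxx.
  by case/andP=> /eqP-> /eqP->.
suff cE : is_coarsest [pred R | refines R P && refines R Q]
   (equivalence_partition r [set: T]).
  by rewrite /common_refinement (coarsest_eq cE).
apply: is_coarsest_equivalence => //=.
  by apply/andP; split; apply: refines_equivalence => // x y /andP[/eqP ? /eqP ?].
move=> R B x y _ /andP[RP RQ] BR xB yB; apply/andP.
by split; apply/eqP; [apply: same_block_refines RP BR _ _|
  apply: same_block_refines RQ BR _ _].
Qed.

End Facts.

Lemma interval_refinementP n (P : {set {set 'I_n}}) :
  partition P [set: 'I_n] ->
  is_coarsest [pred Q | refines Q P && [forall B in Q, is_interval B]]
    (interval_refinement P).
Proof.
move=> parP.
pose btw (x y k : 'I_n) := (x <= k <= y) || (y <= k <= x).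
pose r := [rel x y | [forall k, btw x y k ==> (pblock P k == pblock P x)]].
have rP x y : reflect (forall k, btw x y k -> pblock P k = pblock P x) (r x y).
  by apply: (iffP forallP) => h k; [have /implyP hk := h k; move/hk/eqP|
    apply/implyP => /h/eqP].
have rend x y : r x y -> pblock P x = pblock P y.
  by move=> /rP/(_ y) ->; rewrite // /btw !leqnn !andbT leq_total.
have rrefl x : r x x.
  apply/rP => k; rewrite /btw orbb -eqn_leq => /eqP xk.
  by rewrite (val_inj xk).
have rsym x y : r x y -> r y x.
  move=> rxy; apply/rP => k; rewrite /btw orbC => bk.
  by rewrite (rP _ _ rxy k bk) (rend _ _ rxy).
have rtrans x y z : r x y -> r y z -> r x z.
  move=> rxy ryz; apply/rP => k bk.
  have : btw x y k || btw y z k.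
    rewrite /btw in bk *; case: (leqP y k) => yk; case/orP: bk => /andP[h1 h2].
    - by rewrite h2 /= ?orbT.
    - by rewrite h2 /= ?orbT.
    - by rewrite h1 (ltnW yk).
    - by rewrite h1 (ltnW yk) /= ?orbT.
  case/orP=> [/(rP _ _ rxy)//|/(rP _ _ ryz) ->].
  by rewrite (rend _ _ rxy).
have er : equivalence_rel r.
  move=> x y z; split; first exact: rrefl.
  by move=> rxy; apply/idP/idP; apply: rtrans => //; apply: rsym.
suff cE : is_coarsest [pred Q | refines Q P && [forall B in Q, is_interval B]]
   (equivalence_partition r [set: 'I_n]).
  by rewrite /interval_refinement (coarsest_eq cE).
apply: is_coarsest_equivalence => //.
  rewrite inE refines_equivalence //=.
  apply/forall_inP => B /(equivalence_partition_memP er)[x ->].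
  apply/forall_inP => i; rewrite inE => rxi.
  apply/forall_inP => j; rewrite inE => rxj.
  apply/forallP => k; apply/implyP => /andP[ik kj]; rewrite inE.
  apply: (rtrans _ i) => //.
  have rij : r i j by apply: (rtrans _ x) => //; apply: rsym.
  apply/rP => l bl; apply: (rP _ _ rij).
  rewrite /btw in bl *; case/orP: bl => /andP[h1 h2].
    by rewrite h1 (leq_trans h2).
  have /eqP -> : l == i by rewrite -val_eqE /= eqn_leq h2 (leq_trans ik).
  by rewrite leqnn (leq_trans ik kj).
move=> R B x y parR /andP[RP /forall_inP iR] BR xB yB; apply/rP => k bk.
suff kB : k \in B by apply: (same_block_refines parP RP BR).
have iB i j : i \in B -> j \in B -> i <= k <= j -> k \in B.
  by move=> iB jB; apply/implyP; move/forall_inP: (iR B BR) => /(_ i iB)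
    /forall_inP/(_ j jB)/forallP/(_ k).
by case/orP: bk; apply: iB.
Qed.

Lemma partition_preimset (T U : finType) (g : T -> U) (Q : {set {set U}}) :
  (forall y, exists x, g x = y) -> partition Q [set: U] ->
  partition [set g @^-1: B | B : {set U} in Q] [set: T].
Proof.
move=> gsurj parQ; have [covQ triQ nQ0] := and3P parQ; apply/and3P; split.
- apply/eqP/setP => x; rewrite inE; apply/bigcupP.
  have gx : g x \in cover Q by rewrite (eqP covQ) inE.
  exists (g @^-1: pblock Q (g x)); first by apply: imset_f; rewrite pblock_mem.
  by rewrite inE mem_pblock.
- apply/trivIsetP => _ _ /imsetP[B BQ ->] /imsetP[C CQ ->] neBC.
  have {neBC}neBC : B != C by apply: contraNneq neBC => ->.
  rewrite -setI_eq0 -preimsetI.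
  have := trivIsetP triQ _ _ BQ CQ neBC.
  by rewrite -setI_eq0 => /eqP->; rewrite preimset0.
- apply/imsetP => -[B BQ B0].
  have [y yB] : exists y, y \in B by apply/set0Pn; apply: contraNneq nQ0 => <-.
  have [x gx] := gsurj y.
  by have := in_set0 x; rewrite B0 inE gx yB.
Qed.

Lemma partition_extend n (x : 'I_n.+1) (a : 'I_n) (Q : {set {set 'I_n}}) :
  partition Q [set: 'I_n] -> partition (extend x a Q) [set: 'I_n.+1].
Proof.
move=> parQ; pose g (y : 'I_n.+1) := odflt a (unlift x y).
have gl z : g (lift x z) = z by rewrite /g liftK.
have gx : g x = a by rewrite /g unlift_none.
have hasE (B : {set 'I_n}) : has_val a B = (a \in B).
  apply/exists_inP/idP => [[j jB /eqP ja]|aB]; last by exists a.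
  by rewrite -(val_inj ja).
have memlift (B : {set 'I_n}) z : (lift x z \in lift x @: B) = (z \in B).
  by rewrite mem_imset //; exact: lift_inj.
have xlift (B : {set 'I_n}) : x \in lift x @: B = false.
  by apply/negP => /imsetP[z _ /eqP]; rewrite (negPf (neq_lift x z)).
have preE (B : {set 'I_n}) :
    g @^-1: B = if a \in B then x |: lift x @: B else lift x @: B.
  apply/setP => y; rewrite inE; case: (unliftP x y) => [z ->|->].
    rewrite gl; case: ifP => _; rewrite ?inE memlift //.
    by rewrite eq_sym (negPf (neq_lift x z)).
  by rewrite gx; case: ifP => aB; rewrite ?inE ?eqxx ?xlift.
suff -> : extend x a Q = [set g @^-1: B | B : {set 'I_n} in Q].
  by apply: partition_preimset => // y; exists (lift x y).
apply/setP => C; rewrite inE; apply/idP/imsetP => [|[B BQ ->]].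
  case/orP => /imsetP[B]; rewrite inE hasE => /andP[BQ aB] ->; exists B => //.
    by rewrite preE (negPf aB).
  by rewrite preE aB.
rewrite preE; case: ifP => aB; apply/orP; [right|left];
  by apply/imsetP; exists B => //; rewrite inE hasE BQ aB.
Qed.

Lemma partition_derived n (P : {set {set 'I_n}}) : 0 < n ->
  partition P [set: 'I_n] -> partition (derived P) [set: 'I_n.+1].
Proof.
case: n P => // n P _ parP.
have /and3P[parQ _ _] := interval_refinementP parP.
have par1 := partition_extend ord0 (ord0 : 'I_n.+1) parQ.
have par2 := partition_extend ord_max (ord_max : 'I_n.+1) parQ.
by have /and3P[] := common_refinementP par1 par2.
Qed.

(* Main.v *)
(* Write tau_D for the n-pattern of tau left after deleting the positions in D.

   Moving one deleted position from e to e+1 multiplies tau_D by a cycle on the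
   interval [u, w), where u < w are the ranks of tau(e), tau(e+1) among the
   undeleted values; so this cycle lies in Aut Pi.  A cycle on an interval
   I that lies in Aut Pi either fixes every block, or I is a union of at least
   two blocks.  Once two positions are deleted, the other deleted position can
   be varied, which gives several intervals differing by one point or by a
   shift; as no block is a singleton, all the cycles then fix every block,
   unless {tau(e), tau(e+1)} is the set of the two end points and the cycle is
   zeta_n.

   If zeta_n is not in Aut Pi, all tau_D therefore permute the blocks of Pi in
   the same way.  For a pattern rho of length n+1 of tau this forces every
   point c+1 following a boundary c of Pi either to be fixed by rho, with the
   points below it kept below, or to be reversed; one behaviour holds for all
   c, so rho or its reversal preserves Pi', and in the second case delta_n is
   in Aut Pi.  The passage to greater lengths only involves boundaries.

   If zeta_n is in Aut Pi, the same analysis shows that tau maps neighbours to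
   cyclic neighbours, hence is dihedral. *)
Require Import Defs.
From mathcomp Require Import all_boot all_fingroup.
From mathcomp Require Import zify.
Set Implicit Arguments.
Unset Strict Implicit.
Unset Printing Implicit Defensive.
Local Open Scope group_scope.

(** * Deleting one position of a permutation *)

Section Deletion.
Variable n : nat.
Implicit Types (s t : 'S_n.+1) (x : 'I_n.+1).

(** This function is the pattern left when position [x] and value [s x] are deleted. The default [j]
    never occurs, since [s (lift x j)] differs from [s x]. *)
Lemma del_subproof x s :
  injective (fun j => odflt j (unlift (s x) (s (lift x j)))).
Proof.
have ne j : s x != s (lift x j) by rewrite (inj_eq perm_inj) neq_lift.
move=> i j; have [i' si ->] := unlift_some (ne i).
have [j' sj ->] /= := unlift_some (ne j) => ij.
by apply: (@lift_inj _ x); apply: (@perm_inj _ s); rewrite si sj ij.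
Qed.

Definition del x s : 'S_n := perm (@del_subproof x s).

Lemma lift_del x s j : lift (s x) (del x s j) = s (lift x j).
Proof.
have ne : s x != s (lift x j) by rewrite (inj_eq perm_inj) neq_lift.
by rewrite permE; have [i' si ->] := unlift_some ne.
Qed.

Lemma del_eq x s (t : 'S_n) :
  (forall j, lift (s x) (t j) = s (lift x j)) -> del x s = t.
Proof.
by move=> h; apply/permP => j; apply: (@lift_inj _ (s x)); rewrite lift_del h.
Qed.

(** Position [x] becomes [s x] before [t] acts. This cocycle rule stands in for a homomorphism
    property and makes [comp_succ] of a group a group. *)
Lemma delM x s t : del x (s * t) = del x s * del (s x) t.
Proof. by apply: del_eq => j; rewrite !permM !lift_del. Qed.

Lemma del1 x : del x 1 = 1.
Proof. by apply: del_eq => j; rewrite !perm1. Qed.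

Lemma delV x s : del (s x) s^-1 = (del x s)^-1.
Proof. by apply/eqP; rewrite eq_sym eq_invg_mul -delM mulgV del1. Qed.

Definition comp_succ (G : {set 'S_n}) : {set 'S_n.+1} :=
  [set s | [forall x, del x s \in G]].

Lemma comp_succP (G : {set 'S_n}) s :
  reflect (forall x, del x s \in G) (s \in comp_succ G).
Proof. by rewrite inE; apply: forallP. Qed.

Lemma group_set_comp_succ (G : {group 'S_n}) : group_set (comp_succ G).
Proof.
apply/group_setP; split=> [|s t /comp_succP sG /comp_succP tG].
  by apply/comp_succP => x; rewrite del1.
by apply/comp_succP => x; rewrite delM groupM.
Qed.

Canonical comp_succ_group G := Group (group_set_comp_succ G).

(** For [u < w] this is the cycle z -> z + 1 on [u, w), with w - 1 going to u. As a deletion it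
    falls under the rules for [del]. *)
Definition cyc (u w : 'I_n.+1) : 'S_n := del u (tperm u w).

Lemma cycV (u w : 'I_n.+1) : (cyc u w)^-1 = cyc w u.
Proof. by rewrite /cyc -delV tpermL tpermV tpermC. Qed.

Lemma cycE (u w : 'I_n.+1) (z : 'I_n) : u < w ->
  cyc u w z = (if z.+1 == w then u : nat else if u <= z < w then z.+1 else z) :> nat.
Proof.
move=> uw; have := lift_del u (tperm u w) z; rewrite -/(cyc u w) tpermL.
have [lz|lz] := eqVneq (lift u z) w.
  rewrite lz tpermR => /(congr1 val); move/(congr1 val): lz => /=.
  rewrite /bump; case: ifP; lia.
rewrite tpermD ?neq_lift // 1?eq_sym // => /(congr1 val) /=.
by rewrite /bump; do 2?[case: ifP]; lia.
Qed.

(** Conjugation turns [tperm y y' * s] into [s * tperm (s y) (s y')]. Deleting [y] on both sides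
    gives the claim, since an adjacent transposition becomes trivial once [y] is deleted. *)
Lemma del_adjacent s (y y' : 'I_n.+1) : y' = y.+1 :> nat ->
  del y' s = del y s * cyc (s y) (s y').
Proof.
move=> yy'; have d1 : del y (tperm y y') = 1.
  apply: del_eq => j; rewrite tpermL perm1; apply: val_inj.
  have [j1|j1] := eqVneq (lift y j) y'.
    rewrite j1 tpermR; move/(congr1 val): j1 => /=; rewrite /bump; lia.
  rewrite tpermD ?neq_lift // 1?eq_sym //.
  move: j1; rewrite -val_eqE /= /bump; lia.
have: del y (tperm y y' * s) = del y (s * tperm (s y) (s y')).
  by rewrite -tpermJ conjgE mulKVg.
by rewrite !delM d1 mul1g tpermL.
Qed.

End Deletion.

(** Both sides delete positions [x] and [x'], in opposite orders; [y] and [y'] name the second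
    position once the first is gone. *)
Lemma del_delC n (s : 'S_n.+2) (x x' : 'I_n.+2) (y y' : 'I_n.+1) :
  x' = lift x y -> lift x' y' = x -> del y (del x s) = del y' (del x' s).
Proof.
move=> ex ey.
have li (j : 'I_n) : lift x (lift y j) = lift x' (lift y' j).
  move/(congr1 val): ex => /= ex; move/(congr1 val): ey => /= ey.
  apply: val_inj => /=; move: ex ey; rewrite /bump; lia.
have lj (j : 'I_n) : lift (s x) (lift (del x s y) j) = lift (s x') (lift (del x' s y') j).
  have /(congr1 val)/= e1 := lift_del x s y.
  have /(congr1 val)/= e2 := lift_del x' s y'.
  move: e1 e2; rewrite -ex ey => e1 e2.
  apply: val_inj => /=; move: e1 e2; rewrite /bump; lia.
apply: del_eq => j; apply: (@lift_inj _ (s x)).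
by rewrite lj !lift_del -li.
Qed.

(** * Pattern involvement in terms of deletions *)

Lemma homo_ord_geq n m (f : 'I_n -> 'I_m) :
  {homo f : i j / i < j} -> forall j : 'I_n, j <= f j.
Proof.
move=> hf [j jn]; elim: j jn => // j IH jn.
exact: leq_ltn_trans (IH (ltnW jn)) (hf (Ordinal (ltnW jn)) (Ordinal jn) _).
Qed.

Lemma mono_ord_inj n m (f : 'I_n -> 'I_m) :
  {homo f : i j / i < j} -> injective f.
Proof.
move=> hf i j fij; apply: val_inj; case: (ltngtP i j) => // /hf;
  by rewrite fij ltnn.
Qed.

Lemma homo_ord_id n (f : 'I_n -> 'I_n) : {homo f : i j / i < j} -> f =1 id.
Proof.
move=> hf j; apply: val_inj; have := homo_ord_geq hf j.
(* Conjugation by the reversal turns the lower bound into an upper bound. *)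
have hr : {homo (fun i => rev_ord (f (rev_ord i))) : i k / i < k}.
  move=> i k ik /=; have := hf (rev_ord k) (rev_ord i).
  have := ltn_ord (f (rev_ord i)); have := ltn_ord (f (rev_ord k)).
  have := ltn_ord k; rewrite /=; lia.
have := homo_ord_geq hr (rev_ord j); rewrite /= rev_ordK.
have := ltn_ord (f j); have := ltn_ord j; rewrite /=; lia.
Qed.

Lemma involvesP m n (s : 'S_m) (t : 'S_n) :
  reflect (exists2 f : 'I_n -> 'I_m, {homo f : i j / i < j}
             & forall i j, (s (f i) < s (f j)) = (t i < t j)) (involves s t).
Proof.
apply: (iffP existsP) => [[f /andP[h1 h2]]|[f h1 h2]].
  exists f => [i j ij|i j].
    by have /implyP := forallP (forallP h1 i) j; apply.
  by have /eqP := forallP (forallP h2 i) j.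
exists (finfun f); apply/andP; split; apply/forallP => i; apply/forallP => j.
  by rewrite !ffunE; apply/implyP/h1.
by rewrite !ffunE h2.
Qed.

Lemma CompP n m (S : {set 'S_n}) (t : 'S_m) :
  reflect (forall u, involves t u -> u \in S) (t \in Comp m S).
Proof.
by rewrite inE; apply: (iffP forallP) => h u; have := h u; move/implyP.
Qed.

Lemma Comp_id n (S : {set 'S_n}) : Comp n S = S.
Proof.
apply/setP => s; apply/CompP/idP => [|sS u].
  by apply; apply/involvesP; exists id.
case/involvesP => f hf fu; suff -> : u = s by [].
have id_us : {homo (fun j => u (s^-1 j)) : i j / i < j}.
  by move=> i j; rewrite -fu !(homo_ord_id hf) !permKV.
by apply/permP => j; have := homo_ord_id id_us (s j); rewrite /= permK.
Qed.

(** An increasing map from n points to m + 1 points misses some position [x], so every n-pattern of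
    [s] already occurs in some [del x s]. *)
Lemma Comp_succ n m (S : {set 'S_n}) : n <= m ->
  Comp m.+1 S = comp_succ (Comp m S).
Proof.
have ltl k (x : 'I_k.+1) (i j : 'I_k) : (lift x i < lift x j) = (i < j).
  rewrite /= /bump; lia.
move=> nm; apply/setP => s; apply/CompP/comp_succP => [sS x|sS u].
  apply/CompP => u /involvesP[f hf fu]; apply: sS; apply/involvesP.
  exists (fun j => lift x (f j)) => i j; first by move/hf; rewrite ltl.
  by rewrite -!lift_del ltl fu.
case/involvesP => f hf fu.
have [x xf] : exists x, x \notin codom f.
  apply/existsP; rewrite -negb_forall; apply/negP => /forallP h.
  have := subset_leq_card (introT subsetP (fun x (_ : x \in 'I_m.+1) => h x)).
  by rewrite (card_codom (mono_ord_inj hf)) !card_ord => /leq_trans/(_ nm); rewrite ltnn.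
have nx j : x != f j by apply: contraNneq xf => ->; apply: codom_f.
pose g (j : 'I_n) : 'I_m := odflt (widen_ord nm j) (unlift x (f j)).
have lg j : lift x (g j) = f j by rewrite /g; have [k -> ->] := unlift_some (nx j).
apply: (CompP _ _ (sS x)); apply/involvesP; exists g => i j.
  by move/hf; rewrite -!lg ltl.
by rewrite -fu -!lg -!lift_del ltl.
Qed.

(** Deleting the position of the value [v] keeps [e] and [e'] adjacent and turns their images into
    [u] and [w]. *)
Lemma adjacent_del n (s : 'S_n.+1) (Q : 'I_n -> 'I_n -> Prop) :
    (forall x (y y' : 'I_n), y' = y.+1 :> nat -> Q (del x s y) (del x s y')) ->
  forall e e' : 'I_n.+1, e' = e.+1 :> nat ->
  forall (v : 'I_n.+1) u w, lift v u = s e -> lift v w = s e' -> Q u w.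
Proof.
move=> hQ e e' ee' v u w eu ew; set x := s^-1 v.
have sx : s x = v by rewrite permKV.
have xe : x != e by rewrite -(inj_eq (@perm_inj _ s)) sx -eu neq_lift.
have xe' : x != e' by rewrite -(inj_eq (@perm_inj _ s)) sx -ew neq_lift.
have [y ey _] := unlift_some xe; have [y' ey' _] := unlift_some xe'.
have yy' : y' = y.+1 :> nat.
  move: xe xe'; rewrite -!val_eqE /=.
  by move/(congr1 val): ey; move/(congr1 val): ey'; rewrite /= /bump; lia.
have <- : del x s y = u by apply: (@lift_inj _ v); rewrite eu -sx lift_del -ey.
have <- : del x s y' = w by apply: (@lift_inj _ v); rewrite ew -sx lift_del -ey'.
exact: hQ.
Qed.

(** * Labellings, and interval cycles that respect them *)

Section Labels.
Variables (n : nat) (T : eqType) (b : 'I_n -> T).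
Implicit Types (s t : 'S_n) (u w : 'I_n.+1) (z : 'I_n).

Definition respects s := forall x y, (b (s x) == b (s y)) = (b x == b y).
Definition fixes s := forall x, b (s x) = b x.

Lemma respects1 : respects 1.
Proof. by move=> x y; rewrite !perm1. Qed.

Lemma respectsM s t : respects s -> respects t -> respects (s * t).
Proof. by move=> rs rt x y; rewrite !permM rt rs. Qed.

Lemma respectsV s : respects s -> respects s^-1.
Proof. by move=> rs x y; rewrite -rs !permKV. Qed.

Lemma fixes_respects s : fixes s -> respects s.
Proof. by move=> fs x y; rewrite !fs. Qed.

Lemma fixesV s : fixes s -> fixes s^-1.
Proof. by move=> fs x; rewrite -[in RHS](permKV s x) fs. Qed.

(** As the cycle respects [b], whether it preserves the label of a point has the same answer at the
    point and at its image, hence all along the cycle. *)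
Lemma cyc_fixes u w z : u < w -> respects (cyc u w) ->
  u <= z < w -> b (cyc u w z) = b z -> fixes (cyc u w).
Proof.
move=> uw rc zI hz.
have step (t t' : 'I_n) : t' = cyc u w t -> (b (cyc u w t') == b t') = (b (cyc u w t) == b t).
  by move=> ->; apply: rc.
have [t0 t0u] : exists t0 : 'I_n, t0 = u :> nat.
  have lt : u < n by have := ltn_ord z; lia.
  by exists (Ordinal lt).
have cu d (t : 'I_n) : t = (u + d)%N :> nat -> t < w ->
    (b (cyc u w t) == b t) = (b (cyc u w t0) == b t0).
  elim: d t => [|d IH] t td tw.
    by have -> : t = t0 by apply: val_inj; rewrite /= td t0u addn0.
  have lt : u + d < n by have := ltn_ord t; lia.
  rewrite -(IH (Ordinal lt)) //=; last lia.
  apply: step; apply: val_inj; rewrite /= cycE //=; do ?[case: ifP]; lia.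
have all_t (t : 'I_n) : u <= t < w -> (b (cyc u w t) == b t) = (b (cyc u w t0) == b t0).
  by move=> tI; apply: (cu (t - u)%N); lia.
move=> t; have [tI|tI] := boolP (u <= t < w).
  by apply/eqP; rewrite all_t // -(all_t z) // hz.
congr b; apply: val_inj; rewrite /= cycE //; do ?[case: ifP]; lia.
Qed.

(** [x] is a fixed point with the label of [z], so the image of [z] keeps that label. Hence the
    interval of a cycle that moves labels shares no label with its complement. *)
Lemma cyc_closed u w (x z : 'I_n) : u < w -> respects (cyc u w) ->
  ~~ (u <= x < w) -> u <= z < w -> b x = b z -> fixes (cyc u w).
Proof.
move=> uw rc xI zI /eqP bxz; apply: (cyc_fixes (z := z)) => //.
have cx : cyc u w x = x.
  apply: val_inj; rewrite /= cycE //; do ?[case: ifP]; lia.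
by rewrite -rc cx in bxz; rewrite -(eqP bxz); move: bxz; rewrite -{1}cx rc => /eqP.
Qed.

Hypothesis no_single : forall x, exists2 y, y != x & b y = b x.

(** If the first cycle moved labels, so would the second, as they agree at some point, and both
    intervals would be unions of label classes. Then a point in just one interval, with the rest of
    that interval inside the other, would be alone in its class. *)
Lemma cyc_pair u w u' w' : u < w -> u' < w' ->
    respects (cyc u w) -> respects (cyc u' w') ->
    u <= u'.+1 -> u' <= u.+1 -> w <= w'.+1 -> w' <= w.+1 ->
    [|| (u != u') && (w == w'), (u == u') && (w != w'),
      (u < u') && (w < w') | (u' < u) && (w' < w)] ->
  fixes (cyc u w).
Proof.
move=> uw uw' rc rc' h1 h2 h3 h4 hd.
rewrite -!val_eqE /= in hd.
have dec : fixes (cyc u w) \/ ~ fixes (cyc u w).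
  have [/forallP h|/forallP h] := boolP [forall x, b (cyc u w x) == b x].
    by left=> x; apply/eqP.
  by right=> h'; apply: h => x; rewrite h'.
case: dec => // nf.
have nmove z : u <= z < w -> b (cyc u w z) != b z.
  by move=> zI; apply/eqP => /(cyc_fixes uw rc zI)/nf.
have closed (x z : 'I_n) : ~~ (u <= x < w) -> u <= z < w -> b x != b z.
  by move=> xI zI; apply/eqP => /(cyc_closed uw rc xI zI)/nf.
(* In an interval of at most two points, the partner of the first point would be its image under the
   cycle, against [nmove]. *)
have w3 : u.+2 < w.
  have lt : u < n by have := ltn_ord w; lia.
  have [y yu byu] := no_single (Ordinal lt).
  have yI : u <= y < w.
    apply/negPn/negP => yI; have := closed y (Ordinal lt) yI; rewrite byu eqxx /=; lia.
  rewrite ltnNge; apply/negP => w2.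
  have yE : y = cyc u w (Ordinal lt).
    apply: val_inj; rewrite /= cycE //=; move: yu; rewrite -val_eqE /=.
    do ?[case: ifP]; lia.
  have := nmove (Ordinal lt); rewrite -yE byu eqxx /=; lia.
(* Both cycles send the larger left end to its successor. *)
have [r [rI rJ r1]] : exists r : 'I_n, [/\ u <= r < w, u' <= r < w' & (r.+1 < w) && (r.+1 < w')].
  have lt : maxn u u' < n by have := ltn_ord w; lia.
  exists (Ordinal lt); rewrite /=; split; lia.
have nf' : ~ fixes (cyc u' w').
  move=> /(_ r) br; have /eqP := nmove r rI; case; rewrite -br; congr b.
  apply: val_inj; rewrite /= !cycE //; do ?[case: ifP]; lia.
have closed' (x z : 'I_n) : ~~ (u' <= x < w') -> u' <= z < w' -> b x != b z.
  by move=> xI zI; apply/eqP => /(cyc_closed uw' rc' xI zI)/nf'.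
have [x xIJ] : exists x : 'I_n,
    ((u <= x < w) && ~~ (u' <= x < w') &&
       [forall y : 'I_n, (u <= y < w) ==> (y != x) ==> (u' <= y < w')]) ||
    ((u' <= x < w') && ~~ (u <= x < w) &&
       [forall y : 'I_n, (u' <= y < w') ==> (y != x) ==> (u <= y < w)]).
  have mk m : m < n -> ((u <= m < w) && ~~ (u' <= m < w') &&
      ((u' <= u + (u == m :> nat)) && (w <= w' + (w == m.+1 :> nat)))) ||
    ((u' <= m < w') && ~~ (u <= m < w) &&
      ((u <= u' + (u' == m :> nat)) && (w' <= w + (w' == m.+1 :> nat)))) ->
    exists x : 'I_n,
    ((u <= x < w) && ~~ (u' <= x < w') &&
       [forall y : 'I_n, (u <= y < w) ==> (y != x) ==> (u' <= y < w')]) ||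
    ((u' <= x < w') && ~~ (u <= x < w) &&
       [forall y : 'I_n, (u' <= y < w') ==> (y != x) ==> (u <= y < w)]).
    move=> mn hm; exists (Ordinal mn); case/orP: hm => /andP[hm hm'];
      rewrite /= hm /=; apply/orP; [left|right];
      apply/forallP => y; rewrite -val_eqE /=; lia.
  have := ltn_ord w; have := ltn_ord w'.
  case: (ltngtP u u') => huu.
  - by move=> *; apply: (mk u); lia.
  - by move=> *; apply: (mk u'); lia.
  case: (ltngtP w w') => hww.
  - by move=> *; apply: (mk w); lia.
  - by move=> *; apply: (mk w'); lia.
  - by move: hd; rewrite /= huu hww !eqxx !ltnn.
have [y yx byx] := no_single x.
case/orP: xIJ => /andP[/andP[xI xJ] /forallP/(_ y)].
  have [yI|yI] := boolP (u <= y < w); last by have := closed y x yI xI; rewrite byx eqxx.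
  by rewrite yx /= => yJ; have := closed' x y xJ yJ; rewrite byx eqxx.
have [yI|yI] := boolP (u' <= y < w'); last by have := closed' y x yI xI; rewrite byx eqxx.
by rewrite yx /= => yJ; have := closed x y xJ yJ; rewrite byx eqxx.
Qed.

Lemma cyc_zeta u w : u = 0 :> nat -> w = n :> nat -> cyc u w = zeta n.
Proof.
move=> u0 wn; apply/permP => z; apply: val_inj; have := ltn_ord z => zn.
rewrite /= cycE ?permE /= ?u0 ?wn; last lia.
have [->|ne] := eqVneq z.+1 n; first by rewrite modnn.
by rewrite zn modn_small //; lia.
Qed.

(* The interval [u0, w0) depends only on whether the third deleted point v lies
   below, between or above u and w, and two of these three intervals differ by
   a single point or by a shift by one. *)
Lemma cyc_regions (u w : 'I_n.+2) : u < w ->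
    (forall (v : 'I_n.+2) u0 w0, lift v u0 = u -> lift v w0 = w -> respects (cyc u0 w0)) ->
  [/\ u = 0 :> nat, w = n.+1 :> nat & respects (zeta n)]
  \/ forall (v : 'I_n.+2) u0 w0, lift v u0 = u -> lift v w0 = w -> fixes (cyc u0 w0).
Proof.
move=> uw hc.
have n_gt0 (z : 'I_n) : 0 < n by have := ltn_ord z; lia.
have get (v : 'I_n.+2) : v != u -> v != w -> exists u0 w0, lift v u0 = u /\ lift v w0 = w.
  by move=> /unlift_some[u0 ? _] /unlift_some[w0 ? _]; exists u0, w0.
have other (v' v : 'I_n.+2) u0 w0 : lift v u0 = u -> lift v w0 = w -> u.+1 < w ->
    v' != u -> v' != w -> ((v' < u) != (v < u)) || ((v' < w) != (v < w)) ->
    fixes (cyc u0 w0).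
  move=> eu ew u1w nu nw hv; have [u1 [w1 [eu' ew']]] := get v' nu nw.
  move: (hc _ _ _ eu ew) (hc _ _ _ eu' ew') => r0 r1.
  move/(congr1 val): eu ; move/(congr1 val): eu'.
  move/(congr1 val): ew ; move/(congr1 val): ew' => /= f1 f2 f3 f4.
  move: nu nw; rewrite -!val_eqE /= => nu nw.
  by apply: (cyc_pair (u' := u1) (w' := w1)) => //; move: f1 f2 f3 f4; rewrite -?val_eqE /= /bump; lia.
have [/andP[/eqP u0 /eqP wn]|nuw] := boolP ((u == 0 :> nat) && (w == n.+1 :> nat)).
  case: (posnP n) => [n0|n0]; first by right=> v u0' w0' _ _ z; have := n_gt0 z; lia.
  (* The value 1 lies strictly between the ends, so deleting it leaves 0 and n, whose cycle is
     [zeta n]. *)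
  left; split=> //; have lt : 1 < n.+2 by [].
  have [||u1 [w1 [eu ew]]] := get (Ordinal lt); rewrite -?val_eqE /=; try lia.
  rewrite -(@cyc_zeta u1 w1); first exact: hc eu ew.
    move/(congr1 val): eu => /=; rewrite /bump; lia.
  move/(congr1 val): ew => /=; rewrite /bump; lia.
right=> v u0 w0 eu ew.
have vu : v != u by rewrite -eu neq_lift.
have vw : v != w by rewrite -ew neq_lift.
move: (vu) (vw); rewrite -!val_eqE /= => nvu nvw.
have [u1w|u1w] := ltnP u.+1 w; last first.
  move=> z; congr b; apply: val_inj.
  move/(congr1 val): eu; move/(congr1 val): ew => /= f1 f2.
  rewrite /= cycE; do ?[case: ifP]; move: f1 f2; rewrite /bump; lia.
(* The comparison value lies in another region: 0 or the last value if [v] is between, u + 1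
   otherwise. One of the two extreme values is free because u and w are not both extreme. *)
have [vI|vI] := boolP (u < v < w).
  have [u_gt0|u_le0] := ltnP 0 u.
    by apply: (other ord0 v u0 w0 eu ew u1w); rewrite -?val_eqE /=; lia.
  by apply: (other ord_max v u0 w0 eu ew u1w); have := ltn_ord w; rewrite -?val_eqE /=; lia.
have lt : u.+1 < n.+2 by have := ltn_ord w; lia.
by apply: (other (Ordinal lt) v u0 w0 eu ew u1w); rewrite -?val_eqE /=; lia.
Qed.

End Labels.

(** * The reversal, and cuts kept by a permutation *)

Lemma deltaE n (x : 'I_n) : delta n x = rev_ord x.
Proof. exact: permE. Qed.

Lemma del_delta n (x : 'I_n.+1) : del x (delta n.+1) = delta n.
Proof.
apply: del_eq => j; apply: val_inj; rewrite !deltaE /= /bump.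
have := ltn_ord x; have := ltn_ord j; lia.
Qed.

(** The value [s c] counts the values below it, which are the images of the points below [c]. *)
Lemma perm_lt_fix m (s : 'S_m) (c : 'I_m) :
  (forall x, (s x < s c) = (x < c)) -> s c = c.
Proof.
have card_lt (k : 'I_m) : #|[set x : 'I_m | x < k]| = k.
  have <- : [set widen_ord (ltnW (ltn_ord k)) i | i : 'I_k] = [set x : 'I_m | x < k].
    apply/setP => x; rewrite inE; apply/imsetP/idP => [[i _ ->] /=|xk]; first exact: ltn_ord.
    by exists (Ordinal xk) => //; apply: val_inj.
  by rewrite card_imset ?card_ord // => i j /(congr1 val) /= /val_inj.
move=> h; apply: val_inj; rewrite /= -(card_lt c) -(card_lt (s c)).
rewrite -[in RHS](card_imset _ (@perm_inj _ s)); congr #|pred_of_set _|.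
apply/setP => y; rewrite inE; apply/idP/imsetP => [yc|[x + ->]]; last by rewrite inE h.
by exists (s^-1 y); rewrite ?permKV // inE -h permKV.
Qed.

(* A cut point c stands for the boundary between the values c - 1 and c. *)
Definition keeps (K : pred nat) m (s : 'S_m) :=
  forall c, K c -> forall x, (s x < c) = (x < c).

(** Passing from Pi to Pi' replaces a boundary c by c and c + 1, isolating the point c. At c = 0 the
    predecessor is again 0, so no cut is added there. *)
Definition succ_cuts (K : pred nat) : pred nat := fun c => K c || K c.-1.

Section KeepsDel.
Variables (K : pred nat) (k : nat).
Implicit Types (s : 'S_k.+1) (x y : 'I_k.+1).

Lemma del_keeps_lt s x y c : K c -> keeps K (del x s) -> y != x ->
  (y < c + (x < c)) = (s y < c + (s x < c)).
Proof.
rewrite eq_sym => Kc h /unlift_some[j -> _]; have := h c Kc j.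
have /(congr1 val)/= := lift_del x s j; rewrite /bump; lia.
Qed.

Lemma keeps_del s x : keeps (succ_cuts K) s -> keeps K (del x s).
Proof.
move=> h c Kc j.
have h0 : forall x, (s x < c) = (x < c) by apply: h; rewrite /succ_cuts Kc.
have h1 : forall x, (s x < c.+1) = (x < c.+1) by apply: h; rewrite /succ_cuts /= Kc orbT.
have := h0 x; have := h1 x; have := h0 (lift x j); have := h1 (lift x j).
rewrite -lift_del /= /bump; lia.
Qed.

(** Deletions at [x] and at c bound [s x] by c from the proper side. Deleting the last point then
    settles the cut c, and deleting the first point settles c + 1. *)
Lemma keeps_succ s : (forall c, K c -> 0 < c < k) ->
  (forall x, keeps K (del x s)) -> keeps (succ_cuts K) s.
Proof.
move=> K0 hs.
suff both c : K c -> forall x, (s x < c) = (x < c) /\ (s x < c.+1) = (x < c.+1).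
  move=> c /orP[/both h x|]; first by case: (h x).
  case: c => [|c] /both h x; last by case: (h x).
  by rewrite !ltn0.
move=> Kc; have := K0 _ Kc => c0k.
have H x y : y != x -> (y < c + (x < c)) = (s y < c + (s x < c)) by exact: del_keeps_lt.
have ck : c < k.+1 by lia.
pose co := Ordinal ck.
have le x : x < c -> s x <= c.
  move=> xc; have ne : co != x by rewrite -val_eqE /=; lia.
  have := H _ _ ne; have := H co x; rewrite eq_sym ne => /(_ isT) /=; lia.
have ge x : c < x -> c <= s x.
  move=> xc; have ne : co != x by rewrite -val_eqE /=; lia.
  have := H _ _ ne; have := H co x; rewrite eq_sym ne => /(_ isT) /=; lia.
have lt x : (s x < c) = (x < c).
  have := ge ord_max; have [->|ne] := eqVneq x ord_max; first by rewrite /=; lia.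
  have := H _ _ ne; rewrite /=; lia.
move=> x; split=> //; have := lt ord0; have := le ord0.
have [->|ne] := eqVneq x ord0; first by rewrite /=; lia.
have := H _ _ ne; rewrite /=; lia.
Qed.

(** Keeping c and c + 1 forces the images of 0, c, k - 1 to increase, or to decrease if the cuts are
    kept after reversal. Moving the deleted position by one alters at most one of these images, so
    one alternative holds for all positions. *)
Lemma keeps_succ_or s c : (forall c, K c -> 0 < c < k) ->
    0 < c -> c.+1 < k -> K c -> K c.+1 ->
    (forall x, keeps K (del x s) \/ keeps K (del x s * delta k)) ->
  keeps (succ_cuts K) s \/ keeps (succ_cuts K) (s * delta k.+1).
Proof.
move=> K0 c0 ck Kc Kc1 hs.
have k0 : 0 < k by lia.
have ck' : c < k by lia.
have km : k.-1 < k by lia.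
pose j0 := Ordinal k0; pose jc := Ordinal ck'; pose jm := Ordinal km.
pose inc (x : 'I_k.+1) := (del x s j0 < del x s jc) && (del x s jc < del x s jm).
pose dec (x : 'I_k.+1) := (del x s jc < del x s j0) && (del x s jm < del x s jc).
have incE x : keeps K (del x s) -> inc x.
  move=> h; have e := h _ Kc; have e1 := h _ Kc1.
  move: (e j0) (e jc) (e jm) (e1 j0) (e1 jc) (e1 jm); rewrite /inc /=; lia.
have decE x : keeps K (del x s * delta k) -> dec x.
  move=> h; have e := h _ Kc; have e1 := h _ Kc1.
  move: (e j0) (e jc) (e jm) (e1 j0) (e1 jc) (e1 jm); rewrite /dec !permM !deltaE /=.
  have := ltn_ord (del x s j0); have := ltn_ord (del x s jc); have := ltn_ord (del x s jm); lia.
have cmp (x : 'I_k.+1) i j : (del x s i < del x s j) = (s (lift x i) < s (lift x j)).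
  rewrite -!lift_del /= /bump; lia.
(* lift x and lift x' only differ at x, so they agree on two of the three
   points 0, c, k-1. *)
have adj (x x' : 'I_k.+1) : x' = x.+1 :> nat ->
    ~~ (inc x && dec x') && ~~ (dec x && inc x').
  move=> xx'; have li (i : 'I_k) : i != x :> nat -> lift x i = lift x' i.
    by move=> ix; apply: val_inj; rewrite /= /bump; lia.
  rewrite /inc /dec !cmp.
  have [e0|/li ->] := eqVneq (j0 : nat) x.
    have nc : jc != x :> nat by rewrite -e0 /=; lia.
    have nm : jm != x :> nat by rewrite -e0 /=; lia.
    rewrite (li _ nc) (li _ nm); lia.
  have [ec|/li ->] := eqVneq (jc : nat) x; last by lia.
  have nm : jm != x :> nat by rewrite -ec /=; lia.
  rewrite (li _ nm); lia.
have excl x : inc x -> dec x -> False by rewrite /inc /dec; lia.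
have same m (mk : m < k.+1) : inc (Ordinal mk) = inc ord0.
  elim: m mk => [|m IH] mk; first by congr inc; apply: val_inj.
  have mk' : m < k.+1 by lia.
  rewrite -(IH mk'); apply/idP/idP => hi.
    case: (hs (Ordinal mk')) => [/incE //|/decE hd].
    by have := adj (Ordinal mk') (Ordinal mk) erefl; rewrite hi hd andbF.
  case: (hs (Ordinal mk)) => [/incE //|/decE hd].
  by have := adj (Ordinal mk') (Ordinal mk) erefl; rewrite hi hd.
have same' x : inc x = inc ord0 by case: x => m mk; apply: same.
have [i0|i0] := boolP (inc ord0); [left|right]; apply: keeps_succ => // x.
  case: (hs x) => // /decE hd; case: (excl x) => //.
  by rewrite same'.
rewrite delM del_delta; case: (hs x) => // /incE; by rewrite same' (negPf i0).
Qed.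

End KeepsDel.

(** * Cuts of a labelling *)

Definition cut n (T : eqType) (b : 'I_n -> T) : pred nat := fun c =>
  [exists x : 'I_n, exists y : 'I_n, [&& x.+1 == c, y == c :> nat & b x != b y]].

Section Cuts.
Variables (n : nat) (T : eqType) (b : 'I_n -> T).

Lemma cutP c : reflect
  (exists x y : 'I_n, [/\ x.+1 = c, y = c :> nat & b x != b y]) (cut b c).
Proof.
apply: (iffP existsP) => [[x /existsP[y /and3P[/eqP ? /eqP ? ?]]]|[x [y [? ? ?]]]].
  by exists x, y.
by exists x; apply/existsP; exists y; apply/and3P; split=> //; apply/eqP.
Qed.

Lemma cut_range c : cut b c -> 0 < c < n.
Proof. by move=> /cutP[x [y [? ? _]]]; have := ltn_ord y; lia. Qed.

Lemma no_cut (x y : 'I_n) : (forall c, cut b c -> (x < c) = (y < c)) -> b x = b y.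
Proof.
wlog xy : x y / x <= y => [H h|].
  by case: (leqP x y) => [/H|/ltnW/H h']; [apply | rewrite h' // => c /h].
case: y xy => y yn; elim: y yn => [|y IH] yn xy h.
  by congr b; apply: val_inj; move: xy => /=; lia.
have yn' := ltnW yn; move: xy; rewrite /= leq_eqVlt => /predU1P[xy|xy].
  by congr b; apply: val_inj.
have byy : b (Ordinal yn') = b (Ordinal yn).
  apply/eqP/negPn/negP => ne.
  have /h : cut b y.+1 by apply/cutP; exists (Ordinal yn'), (Ordinal yn).
  by rewrite /= ltnn xy.
rewrite -byy; apply: (IH yn') => // c cc.
have := h c cc; rewrite /= => ->.
have [cy|] := eqVneq c y.+1; last by lia.
by have := h c cc; rewrite cy /=; lia.
Qed.

Lemma keeps_cut_fixes (s : 'S_n) : keeps (cut b) s -> fixes b s.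
Proof. by move=> h x; apply: no_cut => c /h. Qed.

Lemma fixed_cuts_keeps (s : 'S_n.+1) :
  (forall c : 'I_n.+1, cut b c -> forall x, (s x < s c) = (x < c)) ->
  keeps (succ_cuts (cut b)) s.
Proof.
move=> hs.
suff both c : cut b c -> forall x, (s x < c) = (x < c) /\ (s x < c.+1) = (x < c.+1).
  move=> c /orP[/both h x|]; first by case: (h x).
  case: c => [|c] /both h x; last by case: (h x).
  by rewrite !ltn0.
move=> cc x; have cn : c < n.+1 by have := cut_range cc; lia.
have h := hs (Ordinal cn) cc; have sc := perm_lt_fix h.
have hx := h x; rewrite sc /= in hx; split=> //.
rewrite !ltnS leq_eqVlt hx [RHS]leq_eqVlt; congr (_ || _).
by rewrite -[c]/(val (Ordinal cn)) !val_eqE -{1}sc (inj_eq perm_inj).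
Qed.

End Cuts.

(** * Permutations whose deletions act alike on labels *)

Section Boundary.
Variables (n : nat) (T : eqType) (b : 'I_n -> T) (s : 'S_n.+1).
Hypothesis resp : forall x, respects b (del x s).

Hypothesis same : forall x x' j, b (del x s j) = b (del x' s j).

(** Deleting [x] renames position c to c - 1, while deleting [x'] leaves it c. With [s x] and [s x']
    on one side of [s c], the two deletions would send c - 1 and c to the same point, so these would
    share a label. *)
Lemma boundary_sides (c x x' : 'I_n.+1) : cut b c -> x < c < x' ->
  (s x < s c) != (s x' < s c).
Proof.
move=> /cutP[p [q [pc qc bpq]]] /andP[xc xc'].
have lp : lift x p = c by apply: val_inj; rewrite /= /bump; lia.
have lq : lift x' q = c by apply: val_inj; rewrite /= /bump; lia.
apply: contra bpq => /eqP side; rewrite -(resp x) (same x x' q).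
apply/eqP; congr b; apply: val_inj.
have ne z : z != c -> s z != s c :> nat by rewrite val_eqE (inj_eq perm_inj).
have /ne nx : x != c by rewrite -val_eqE /=; lia.
have /ne nx' : x' != c by rewrite -val_eqE /=; lia.
have /(congr1 val)/= := lift_del x s p; have /(congr1 val)/= := lift_del x' s q.
rewrite lp lq /bump; lia.
Qed.

(** By [boundary_sides], order relative to a cut point is either kept ([F]) or reversed ([R]). The
    order of [s ord0] and [s ord_max] tells which, so all cuts behave alike. *)
Lemma keeps_or_reverses : keeps (succ_cuts (cut b)) s \/
  respects b (delta n) /\ keeps (succ_cuts (cut b)) (s * delta n.+1).
Proof.
pose F (c : 'I_n.+1) := [forall x, (s x < s c) == (x < c)].
pose R (c : 'I_n.+1) := [forall x, (s c < s x) == (x < c)].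
have ne x c : x != c -> s x != s c :> nat by rewrite val_eqE (inj_eq perm_inj).
have FR (c : 'I_n.+1) : cut b c -> F c || R c.
  move=> cc; have c0 := cut_range cc.
  have lo : (ord0 : 'I_n.+1) < c by rewrite /=; lia.
  have hi : c < (ord_max : 'I_n.+1) by rewrite /=; lia.
  have side := @boundary_sides c _ _ cc.
  have [s0|s0] := boolP (s ord0 < s c); apply/orP; [left|right];
    apply/forallP => x; apply/eqP;
    (have [->|nx] := eqVneq x c; first by rewrite !ltnn);
    have := ne _ _ nx; move: nx; rewrite -val_eqE /= => nx nsx;
    (have [xc|xc] := ltnP x c; [have := side x ord_max; have := side ord0 ord_max
      |have := side ord0 x]); move: s0; rewrite /= ?xc; lia.
have excl (c c' : 'I_n.+1) : F c -> R c' -> cut b c -> cut b c' -> False.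
  move=> /forallP fc /forallP rc /cut_range c0 /cut_range c0'.
  have := eqP (fc c'); have := eqP (rc c).
  have := eqP (fc ord0); have := eqP (rc ord0); have := eqP (fc ord_max).
  have := eqP (rc ord_max); have [->|nc] := eqVneq c c'; first by rewrite /=; lia.
  have := ne _ _ nc; move: nc; rewrite -val_eqE /=; lia.
have [/forallP allF|/forallPn[c]] := boolP [forall c : 'I_n.+1, cut b c ==> F c].
  left; apply: fixed_cuts_keeps => c cc x; have /implyP/(_ cc)/forallP := allF c.
  by move=> /(_ x)/eqP.
rewrite negb_imply => /andP[cc nF].
have rc : R c by have := FR c cc; rewrite (negPf nF).
have kd : keeps (succ_cuts (cut b)) (s * delta n.+1).
  apply: fixed_cuts_keeps => c' cc' x.
  have /forallP/(_ x)/eqP <- : R c'.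
    by case/orP: (FR c' cc') => // /excl/(_ rc cc' cc).
  rewrite !permM !deltaE /=; have := ltn_ord (s x); have := ltn_ord (s c'); lia.
right; split=> //.
(* The second factor fixes labels because it keeps all cuts of [b]. *)
have -> : delta n = (del ord0 s)^-1 * del ord0 (s * delta n.+1).
  by rewrite delM del_delta mulKg.
apply: respectsM; first exact: respectsV.
exact/fixes_respects/keeps_cut_fixes/keeps_del.
Qed.

End Boundary.

(** * Permutations whose twofold deletions respect labels *)

Section TwoDeletions.
Variables (n : nat) (T : eqType) (b : 'I_n -> T) (s : 'S_n.+2).
Hypothesis no_single : forall x, exists2 y, y != x & b y = b x.
Hypothesis resp : forall x y, respects b (del y (del x s)).

Lemma cyc_respects (e e' : 'I_n.+2) : e' = e.+1 :> nat ->
  forall (v : 'I_n.+2) u0 w0, lift v u0 = s e -> lift v w0 = s e' ->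
    respects b (cyc u0 w0).
Proof.
apply: (@adjacent_del _ s (fun u w => respects b (cyc u w))) => x y y' yy'.
have -> : cyc (del x s y) (del x s y') = (del y (del x s))^-1 * del y' (del x s).
  by rewrite (del_adjacent (del x s) yy') mulKg.
by apply: respectsM => //; apply: respectsV.
Qed.

Lemma adjacent_images (e e' : 'I_n.+2) : e' = e.+1 :> nat ->
  [/\ minn (s e) (s e') = 0, maxn (s e) (s e') = n.+1 & respects b (zeta n)]
  \/ forall (v : 'I_n.+2) u0 w0, lift v u0 = s e -> lift v w0 = s e' ->
       fixes b (cyc u0 w0).
Proof.
move=> ee'; have h := cyc_respects ee'.
have ne : s e != s e' :> nat by rewrite val_eqE (inj_eq perm_inj) -val_eqE /= ee'; lia.
have [lt|lt] := ltnP (s e) (s e').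
  have [[-> -> ?]|] := cyc_regions no_single lt h; [left | by right].
  by [].
have lt' : s e' < s e by lia.
have h' (v : 'I_n.+2) u0 w0 : lift v u0 = s e' -> lift v w0 = s e -> respects b (cyc u0 w0).
  by move=> eu ew; rewrite -cycV; apply/respectsV/(h v).
have [[-> -> ?]|h2] := cyc_regions no_single lt' h'; [left | right].
  by [].
by move=> v u0 w0 eu ew; rewrite -cycV; apply/fixesV/(h2 v).
Qed.

Hypothesis zetaN : ~ respects b (zeta n).

Lemma same_action_adjacent (x : 'I_n.+2) (y y' : 'I_n.+1) :
  y' = y.+1 :> nat -> lift x y' = (lift x y).+1 :> nat ->
  forall j, b (del y (del x s) j) = b (del y' (del x s) j).
Proof.
move=> yy' ll j; have [[_ _ /zetaN//]|h] := adjacent_images ll.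
rewrite (del_adjacent (del x s) yy') permM.
by rewrite (h (s x)) ?lift_del.
Qed.

Lemma same_action_step (x : 'I_n.+2) (y y' : 'I_n.+1) : y' = y.+1 :> nat ->
  forall j, b (del y (del x s) j) = b (del y' (del x s) j).
Proof.
move=> yy' j; have [xy|xy] := eqVneq (x : nat) y.+1; last first.
  apply: same_action_adjacent => //; rewrite /= /bump; lia.
(* Here [x] separates the two positions. The deleted pair goes from {y, y+1} through {y, y+2} to
   {y+1, y+2}, one adjacent move at a time. *)
pose X := lift x y; pose Z := lift x y'.
have vX : X = y :> nat by rewrite /X /= /bump; lia.
have vZ : Z = y.+2 :> nat by rewrite /Z /= /bump; lia.
have val_lift (a : 'I_n.+2) (c : 'I_n.+1) : lift a c = (a <= c) + c :> nat by [].
rewrite (@del_delC _ s x X y y) //; last by apply: val_inj; rewrite /= /bump; lia.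
rewrite (@same_action_adjacent X y y') //; last by rewrite /= /bump; lia.
rewrite (@del_delC _ s X Z y' y); do ?[by apply: val_inj; rewrite /= /bump; lia].
rewrite (@same_action_adjacent Z y y') //; last by rewrite /= /bump; lia.
rewrite (@del_delC _ s Z x y' y') //.
by apply: val_inj; rewrite /= /bump; lia.
Qed.

Lemma same_action (x : 'I_n.+2) (y y' : 'I_n.+1) j :
  b (del y (del x s) j) = b (del y' (del x s) j).
Proof.
suff all0 (z : 'I_n.+1) : b (del z (del x s) j) = b (del ord0 (del x s) j).
  by rewrite !all0.
case: z => z; elim: z => [|z IH] zn.
  by congr (b (del _ _ j)); apply: val_inj.
by rewrite -(IH (ltnW zn)); apply/esym/same_action_step.
Qed.

Lemma two_deletions x : keeps (succ_cuts (cut b)) (del x s) \/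
  respects b (delta n) /\ keeps (succ_cuts (cut b)) (del x s * delta n.+1).
Proof. by apply: keeps_or_reverses => // *; apply: same_action. Qed.

End TwoDeletions.

(** * Blocks as labels *)

Section Blocks.
Variable T : finType.
Implicit Types (P Q R : {set {set T}}) (p : pred {set {set T}}).

Lemma mem_pblockE P x y : partition P [set: T] ->
  (y \in pblock P x) = (pblock P x == pblock P y).
Proof.
by move=> /and3P[/eqP cP tP _]; rewrite eq_pblock // cP inE.
Qed.

Lemma pblock_in P x : partition P [set: T] -> pblock P x \in P.
Proof. by move=> parP; rewrite pblock_mem // (cover_partition parP) inE. Qed.

Lemma pblock_self P x : partition P [set: T] -> x \in pblock P x.
Proof. by move=> parP; rewrite mem_pblockE. Qed.

Lemma coarsest_pblock p (r : rel T) x y : equivalence_rel r ->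
    p (equivalence_partition r [set: T]) ->
    (forall R B x y, partition R [set: T] -> p R -> B \in R ->
       x \in B -> y \in B -> r x y) ->
  (pblock (coarsest p) x == pblock (coarsest p) y) = r x y.
Proof.
move=> er pE sub; rewrite (coarsest_eq (is_coarsest_equivalence er pE sub)).
have er' : {in [set: T] & &, equivalence_rel r} by move=> *; apply: er.
have parE := equivalence_partitionP er'.
by rewrite -mem_pblockE // pblock_equivalence_partition ?inE.
Qed.

Lemma common_refinement_pblock P Q x y :
  partition P [set: T] -> partition Q [set: T] ->
  (pblock (common_refinement P Q) x == pblock (common_refinement P Q) y)
  = (pblock P x == pblock P y) && (pblock Q x == pblock Q y).
Proof.
move=> parP parQ.
pose r := [rel x y | (pblock P x == pblock P y) && (pblock Q x == pblock Q y)].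
rewrite /common_refinement (coarsest_pblock (r := r)) //.
- by move=> u v w /=; split=> [|/andP[/eqP-> /eqP->]]; rewrite ?eqxx.
- apply/andP; split; apply: refines_equivalence => //;
    try (by move=> u v w /=; split=> [|/andP[/eqP-> /eqP->]]; rewrite ?eqxx);
    by move=> u v /andP[/eqP ? /eqP ?].
move=> R B u v _ /andP[RP RQ] BR uB vB; apply/andP.
by split; apply/eqP; [apply: same_block_refines RP BR _ _
  | apply: same_block_refines RQ BR _ _].
Qed.

End Blocks.

Section Permutations.
Variables (n : nat) (P : {set {set 'I_n}}).
Hypothesis parP : partition P [set: 'I_n].

Lemma partition_autP s : reflect (respects (pblock P) s) (s \in partition_aut P).
Proof.
rewrite inE; apply: (iffP forall_inP) => [h x y|h B BP].
  have xB := pblock_self x parP; have BP := pblock_in x parP.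
  have sB : s @: pblock P x = pblock P (s x).
    by apply/esym/def_pblock; [case/and3P: parP | apply: h | apply: imset_f].
  rewrite -!mem_pblockE // -sB; apply/imsetP/idP => [[z zB /perm_inj ->] //|yB].
  by exists y.
have [x xB] : exists x, x \in B.
  by apply/set0Pn; apply: contraTneq BP => ->; case/and3P: parP.
have <- : pblock P x = B by apply: def_pblock => //; case/and3P: parP.
suff -> : s @: pblock P x = pblock P (s x) by apply: pblock_in.
apply/setP => y; apply/imsetP/idP => [[z + ->]|].
  by rewrite !mem_pblockE // h.
by move=> yB; exists (s^-1 y); rewrite ?permKV // mem_pblockE // -h permKV -mem_pblockE.
Qed.

Lemma partition_stabP s : reflect (fixes (pblock P) s) (s \in partition_stab P).
Proof.
rewrite inE; apply: (iffP forall_inP) => [h x|h B BP].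
  apply/esym/eqP; rewrite -mem_pblockE // -(eqP (h _ (pblock_in x parP))).
  by apply: imset_f; apply: pblock_self.
rewrite eqEcard card_imset ?leqnn ?andbT; last exact: perm_inj.
have tP : trivIset P by case/and3P: parP.
apply/subsetP => _ /imsetP[x xB ->].
by rewrite -(def_pblock tP BP xB) mem_pblockE // h.
Qed.

Lemma group_set_partition_aut : group_set (partition_aut P).
Proof.
apply/group_setP; split; first exact/partition_autP/respects1.
by move=> s t /partition_autP hs /partition_autP ht; apply/partition_autP/respectsM.
Qed.

End Permutations.

(** The bounded quantifier gives a boolean relation; a cut at m or above separates nothing. *)
Definition unsep (K : pred nat) m : rel 'I_m :=
  fun x y => [forall c : 'I_m, K c ==> ((x < c) == (y < c))].

Lemma unsepP (K : pred nat) m (x y : 'I_m) :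
  reflect (forall c, K c -> (x < c) = (y < c)) (unsep K x y).
Proof.
apply: (iffP forallP) => [h c Kc|h c]; last by apply/implyP => Kc; rewrite h.
have [cm|cm] := ltnP c m; first by have /implyP/(_ Kc)/eqP := h (Ordinal cm).
by rewrite !(leq_trans _ cm).
Qed.

Lemma unsep_equiv (K : pred nat) m : equivalence_rel (@unsep K m).
Proof.
move=> x y z; split=> [|/unsepP xy]; first exact/unsepP.
by apply/unsepP/unsepP => h c Kc; rewrite -h // xy.
Qed.

Lemma keepsE (K : pred nat) m (s : 'S_m) : keeps K s <-> forall x, unsep K (s x) x.
Proof.
split=> [h x|h c Kc x]; first by apply/unsepP => c /h.
by have /unsepP := h x; apply.
Qed.

(** * The derived partition in terms of its cuts *)

Section Derived.
Variables (n : nat) (P : {set {set 'I_n}}).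
Hypothesis parP : partition P [set: 'I_n].

(** An interval crossing a cut c contains c - 1 and c, which lie in different blocks of [P]; so the
    runs between cuts form the coarsest choice. *)
Lemma interval_refinement_pblock x y :
  (pblock (interval_refinement P) x == pblock (interval_refinement P) y)
  = unsep (cut (pblock P)) x y.
Proof.
have er := @unsep_equiv (cut (pblock P)) n.
rewrite /interval_refinement (coarsest_pblock (r := @unsep (cut (pblock P)) n)) //.
  apply/andP; split.
    by apply: refines_equivalence => // u v /unsepP/no_cut.
  apply/forall_inP => B /(equivalence_partition_memP er)[u ->].
  apply/forall_inP => i; rewrite inE => /unsepP ui.
  apply/forall_inP => j; rewrite inE => /unsepP uj.
  apply/forallP => k; apply/implyP => ikj; rewrite inE.
  by apply/unsepP => c cc; have := ui c cc; have := uj c cc; lia.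
move=> R B u v _ /andP[RP /forall_inP int] BR uB vB; apply/unsepP => c /cutP[p [q [pc qc ne]]].
have mem (i j k : 'I_n) : i \in B -> j \in B -> i <= k <= j -> k \in B.
  by move=> iB jB; apply/implyP; move/forall_inP: (int B BR) => /(_ i iB)
    /forall_inP/(_ j jB)/forallP/(_ k).
have [/eqP //|sep] := boolP ((u < c) == (v < c)); case/eqP: ne.
have [pB qB] : p \in B /\ q \in B.
  have [uc|uc] := ltnP u c.
    by split; apply: (mem u v) => //; lia.
  by split; apply: (mem v u) => //; lia.
exact: same_block_refines RP BR pB qB.
Qed.

(** The extension is the preimage of [Q] under [g], which sends [x] to [a] and undoes [lift x]
    elsewhere. *)
Lemma extend_pblock (Q : {set {set 'I_n}}) (a : 'I_n) (x : 'I_n.+1) :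
  partition Q [set: 'I_n] -> let g y := odflt a (unlift x y) in
  forall y z, (pblock (extend x a Q) y == pblock (extend x a Q) z)
              = (pblock Q (g y) == pblock Q (g z)).
Proof.
move=> parQ g y z; have parE := partition_extend x a parQ.
pose E (B : {set 'I_n}) := if a \in B then x |: lift x @: B else lift x @: B.
have hasE (B : {set 'I_n}) : has_val a B = (a \in B).
  apply/exists_inP/idP => [[j jB /eqP /val_inj <-] //|aB]; by exists a.
have EQ B : B \in Q -> E B \in extend x a Q.
  move=> BQ; rewrite inE /E; case: ifP => aB; apply/orP; [right|left];
    by apply/imsetP; exists B => //; rewrite inE hasE BQ aB.
have memE B w : (w \in E B) = (g w \in B).
  have inl (B' : {set 'I_n}) v : (lift x v \in lift x @: B') = (v \in B').
    by rewrite mem_imset //; exact: lift_inj.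
  have xl (B' : {set 'I_n}) : x \in lift x @: B' = false.
    by apply/negP => /imsetP[v _ /eqP]; rewrite (negPf (neq_lift x v)).
  rewrite /E /g; case: (unliftP x w) => [v ->|->].
    by rewrite /=; case: ifP => _; rewrite ?inE inl // eq_sym (negPf (neq_lift x v)).
  by rewrite /=; case: ifP => aB; rewrite ?inE ?eqxx ?xl.
have tE : trivIset (extend x a Q) by case/and3P: parE.
rewrite -!mem_pblockE //.
rewrite (@def_pblock _ _ (E (pblock Q (g y))) y) ?memE //.
  by apply: EQ; apply: pblock_in.
exact: pblock_self.
Qed.

End Derived.

(** A cut c of [P] becomes c + 1 in the first extension and stays c in the last; the common
    refinement has both. *)
Lemma derived_pblock n (P : {set {set 'I_n}}) x y : 0 < n ->
  partition P [set: 'I_n] ->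
  (pblock (derived P) x == pblock (derived P) y)
  = unsep (succ_cuts (cut (pblock P))) x y.
Proof.
case: n P x y => // n P x y _ parP; pose K := cut (pblock P).
have K0 := @cut_range _ _ (pblock P).
have /and3P[parQ _ _] := interval_refinementP parP.
have par1 := partition_extend ord0 (ord0 : 'I_n.+1) parQ.
have par2 := partition_extend ord_max (ord_max : 'I_n.+1) parQ.
rewrite /derived common_refinement_pblock //.
rewrite (@extend_pblock _ _ ord0 ord0) // (@extend_pblock _ _ ord_max ord_max) //.
rewrite !interval_refinement_pblock // -/K.
have g1 (z : 'I_n.+2) c : K c -> (odflt ord0 (unlift ord0 z) < c) = (z < c.+1).
  by move=> /K0 c0; case: unliftP => [v ->|->] //=; rewrite /bump; lia.
have g2 (z : 'I_n.+2) c : K c -> (odflt ord_max (unlift ord_max z) < c) = (z < c).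
  move=> /K0 c0; case: unliftP => [v ->|->] /=; rewrite /bump; last lia.
  by have := ltn_ord v; lia.
apply/andP/unsepP => [[/unsepP h1 /unsepP h2] c|h].
  case/orP => [Kc|]; first by have := h2 c Kc; rewrite !g2.
  by case: c => [|c] Kc //; have := h1 c Kc; rewrite !g1.
split; apply/unsepP => c Kc; [rewrite !g1 | rewrite !g2] => //; apply: h.
  by rewrite /succ_cuts /= -/K Kc orbT.
by rewrite /succ_cuts -/K Kc.
Qed.

Lemma cut_derived n (P : {set {set 'I_n}}) : 0 < n ->
  partition P [set: 'I_n] ->
  cut (pblock (derived P)) =1 succ_cuts (cut (pblock P)).
Proof.
move=> n0 parP c; apply/cutP/idP => [[x [y [xc yc]]]|Kc].
  rewrite derived_pblock //; apply: contraR => nK; apply/unsepP => c' Kc'.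
  have : c' != c by apply: contraNneq nK => <-.
  lia.
have c0 : 0 < c < n.+1.
  by case/orP: Kc => /cut_range; lia.
have xn : c.-1 < n.+1 by lia.
have yn : c < n.+1 by lia.
exists (Ordinal xn), (Ordinal yn); split=> //=; first lia.
rewrite derived_pblock //; apply/negP => /unsepP/(_ c Kc) /=; lia.
Qed.

Lemma partition_stab_derived n (P : {set {set 'I_n}}) s : 0 < n ->
  partition P [set: 'I_n] ->
  reflect (keeps (succ_cuts (cut (pblock P))) s) (s \in partition_stab (derived P)).
Proof.
move=> n0 parP; apply: (iffP (partition_stabP (partition_derived n0 parP) s)).
  by move=> h; apply/keepsE => x; rewrite -derived_pblock // h.
by move/keepsE=> h x; apply/eqP; rewrite derived_pblock // h.
Qed.

(** * Permutations sending neighbours to cyclic neighbours *)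

Definition cyc_adj m (u w : 'I_m) :=
  [|| w == u.+1 :> nat, u == w.+1 :> nat,
      (u == 0 :> nat) && (w.+1 == m) | (w == 0 :> nat) && (u.+1 == m)].

Definition adj_perm m (s : 'S_m) :=
  forall e e' : 'I_m, e' = e.+1 :> nat -> cyc_adj (s e) (s e').

(** If the images [lo < hi] are not cyclic neighbours, a deleted value between them forces hi = lo +
    2 and one outside forces hi = lo + m - 1. Values of both kinds exist (0 or hi + 1 is outside),
    which gives m = 3. *)
Lemma adj_perm_succ m (s : 'S_m.+1) : 3 < m ->
  (forall x, adj_perm (del x s)) -> adj_perm s.
Proof.
move=> m3 hs e e' ee'.
have H := @adjacent_del _ s (fun u w => cyc_adj u w) (fun x y y' => hs x y y') _ _ ee'.
have ne : s e != s e' :> nat by rewrite val_eqE (inj_eq perm_inj) -val_eqE /= ee'; lia.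
apply/negPn/negP => nadj.
pose lo := minn (s e) (s e'); pose hi := maxn (s e) (s e').
have ltu := ltn_ord (s e); have ltw := ltn_ord (s e').
have H' k : k < m.+1 -> k != s e :> nat -> k != s e' :> nat ->
    if lo < k < hi then hi == lo.+2 else hi == (lo + m.-1)%N.
  move=> km ku kw; pose v := Ordinal km.
  have vu : v != s e by rewrite -val_eqE.
  have vw : v != s e' by rewrite -val_eqE.
  have [u0 eu _] := unlift_some vu; have [w0 ew _] := unlift_some vw.
  have := H v u0 w0 (esym eu) (esym ew); move: nadj.
  move/(congr1 val): eu; move/(congr1 val): ew.
  rewrite /lo /hi /cyc_adj /= /bump; case: ifP; lia.
have lohi : lo.+1 < hi by move: nadj; rewrite /lo /hi /cyc_adj; lia.
have lo_hi k : (k != s e :> nat) && (k != s e' :> nat) = (k != lo) && (k != hi).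
  by rewrite /lo /hi; lia.
have H2 k : k < m.+1 -> (k != lo) && (k != hi) ->
    if lo < k < hi then hi == lo.+2 else hi == (lo + m.-1)%N.
  by rewrite -lo_hi => km /andP[]; apply: H'.
have him : hi < m.+1 by rewrite /hi; lia.
have e1 : hi = lo.+2.
  have [//|ne2] := eqVneq hi lo.+2.
  by have := H2 lo.+1; rewrite ltnSn lohi /= (negPf ne2) => h; have := h; lia.
have n1 : (lo < hi.+1 < hi) = false by lia.
by have := H2 0; have := H2 hi.+1; rewrite ltn0 n1 /=; lia.
Qed.

Lemma zetaE m (x : 'I_m) : zeta m x = x.+1 %% m :> nat.
Proof. by rewrite permE. Qed.

Lemma zetaX m t (x : 'I_m) : (zeta m ^+ t) x = (x + t) %% m :> nat.
Proof.
elim: t => [|t IH]; first by rewrite perm1 addn0 modn_small.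
by rewrite expgSr permM zetaE IH -addn1 modnDml addn1 addnS.
Qed.

Lemma cyc_adj_zeta m (u w : 'I_m) : cyc_adj u w -> w = zeta m u \/ u = zeta m w.
Proof.
have um := ltn_ord u; have wm := ltn_ord w.
have wrap k : k < m -> k.+1 == m -> k.+1 %% m = 0 by move=> _ /eqP ->; rewrite modnn.
case/or4P => [/eqP h|/eqP h|/andP[/eqP h h']|/andP[/eqP h h']]; [left|right|right|left];
  apply: val_inj; rewrite /= zetaE.
- by rewrite -h modn_small.
- by rewrite -h modn_small.
- by rewrite wrap.
- by rewrite wrap.
Qed.

Lemma adj_perm_rotation m (s : 'S_m.+2) : adj_perm s ->
  s (inord 1) = zeta m.+2 (s ord0) -> s = zeta m.+2 ^+ s ord0.
Proof.
move=> hs s1.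
have both k : k.+1 < m.+2 -> s (inord k) = (s ord0 + k) %% m.+2 :> nat /\
    s (inord k.+1) = zeta m.+2 (s (inord k)).
  elim: k => [|k IH] km.
    have -> : inord 0 = ord0 :> 'I_m.+2 by apply: val_inj; rewrite /= inordK.
    by rewrite addn0 modn_small // s1.
  have [v sk] := IH (ltnW km); split.
    by rewrite sk zetaE v -addn1 modnDml addn1 addnS.
  have kk : (inord k.+2 : 'I_m.+2) = (inord k.+1 : 'I_m.+2).+1 :> nat by rewrite !inordK; lia.
  (* Turning back would give k and k + 2 the same image. *)
  have [//|] := cyc_adj_zeta (hs _ _ kk).
  rewrite {1}sk => /perm_inj /perm_inj /(congr1 val); rewrite /= !inordK; lia.
apply/permP => x; apply: val_inj; rewrite /= zetaX addnC.
have [x1|x1] := ltnP x.+1 m.+2.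
  by have [<- _] := both _ x1; rewrite inord_val.
have xm : x = m.+1 :> nat by have := ltn_ord x; lia.
have [v sk] := both m (ltnSn _).
have -> : x = inord m.+1 by apply: val_inj; rewrite /= inordK.
by rewrite sk zetaE v inordK // -addn1 modnDml addn1 addnS.
Qed.

(** If the first step goes up the cycle, [s] is a rotation; a downward step becomes upward after
    composing with the reversal. *)
Lemma adj_perm_dihedral m (s : 'S_m.+2) : adj_perm s -> s \in dihedral m.+2.
Proof.
move=> hs.
have zD : zeta m.+2 \in dihedral m.+2 by apply: mem_gen; rewrite !inE eqxx.
have dD : delta m.+2 \in dihedral m.+2 by apply: mem_gen; rewrite !inE eqxx orbT.
have i1 : (inord 1 : 'I_m.+2) = (ord0 : 'I_m.+2).+1 :> nat by rewrite inordK.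
have [h|h] := cyc_adj_zeta (hs _ _ i1).
  by rewrite (adj_perm_rotation hs h) groupX.
have hd : adj_perm (s * delta m.+2).
  move=> e e' /hs; rewrite /cyc_adj !permM !deltaE /=.
  by have := ltn_ord (s e); have := ltn_ord (s e'); lia.
rewrite -(mulgK (delta m.+2) s) groupM ?groupV // (adj_perm_rotation hd) ?groupX //.
rewrite !permM h !deltaE; apply: val_inj; rewrite /= !zetaE /= zetaE.
have [->|ne] := eqVneq (s (inord 1)).+1 m.+2.
  by rewrite modnn subnn subn1 modnn.
have lt : (s (inord 1)).+2 <= m.+2 by have := ltn_ord (s (inord 1)); lia.
by rewrite (modn_small lt) modn_small; lia.
Qed.

(** The last position carries the wrap-around to 0; deleting it leaves an increasing map. *)
Lemma del_zeta n (x : 'I_n.+1) :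
  del x (zeta n.+1) = if x == ord_max then 1 else zeta n.
Proof.
apply: del_eq => j; apply: val_inj; rewrite /= !zetaE /=.
have jn := ltn_ord j; have xn := ltn_ord x.
have [->|nx] := eqVneq x ord_max.
  rewrite perm1 /= modnn /bump leq0n leqNgt jn /= add0n modn_small //; lia.
have x1 : x.+1 < n.+1 by move: nx; rewrite -val_eqE /=; lia.
rewrite zetaE (modn_small x1).
have [jm|jm] := eqVneq j.+1 n.
  have -> : bump x j = n by rewrite /bump; lia.
  by rewrite jm !modnn.
rewrite !modn_small /bump; lia.
Qed.

(** * Labellings respected by the rotation *)

Section Zeta.
Variables (n : nat) (T : eqType) (b : 'I_n -> T).
Hypothesis zetab : respects b (zeta n).

Lemma respectsX t : respects b (zeta n ^+ t).
Proof.
elim: t => [|t IH]; first exact: respects1.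
by rewrite expgSr; apply: respectsM.
Qed.

(* The rotation by t = - 1 - x - y exchanges x with n - 1 - y and y with
   n - 1 - x. *)
Lemma respects_delta : respects b (delta n).
Proof.
move=> x y; have xn := ltn_ord x; have yn := ltn_ord y.
pose t := (n - x.+1 + (n - y))%N.
have rot (u v : 'I_n) : (u + t)%N = (n + (n - v.+1))%N -> (zeta n ^+ t) u = delta n v.
  move=> e; apply: val_inj.
  rewrite deltaE /= zetaX e modnDl modn_small //; have := ltn_ord v; lia.
rewrite -(rot y x) -?(rot x y); try by rewrite /t; lia.
by rewrite respectsX eq_sym.
Qed.

(** The label of [z] survives every power of the rotation, and the power n - z + x carries [z] to
    [x]. *)
Lemma zeta_fixed_const (z : 'I_n) : b (zeta n z) = b z -> forall x y, b x = b y.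
Proof.
move=> bz; suff all_z x : b x = b z by move=> x y; rewrite !all_z.
have pow t : b ((zeta n ^+ t) z) = b z.
  elim: t => [|t IH]; first by rewrite perm1.
  rewrite -IH expgS permM; apply/eqP; rewrite respectsX; exact/eqP.
rewrite -(pow (n - z + x)%N); congr b; apply: val_inj; rewrite /= zetaX.
have -> : (z + (n - z + x) = n + x)%N by have := ltn_ord z; lia.
by rewrite modnDl modn_small.
Qed.

(** Since u + 1 < w, the cycle agrees with [zeta n] at u. *)
Lemma cyc_fixed_const (u w : 'I_n.+1) : u.+1 < w -> fixes b (cyc u w) ->
  forall x y, b x = b y.
Proof.
move=> uw fc; have lt : u < n by have := ltn_ord w; lia.
apply: (@zeta_fixed_const (Ordinal lt)); rewrite -[RHS]fc; congr b.
apply: val_inj; rewrite /= zetaE cycE /=; last by lia.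
have -> : (u.+1 == w) = false by lia.
by rewrite leqnn modn_small; [case: ifP | ]; have := ltn_ord w; lia.
Qed.

End Zeta.

Lemma two_deletions_adj n (T : eqType) (b : 'I_n -> T) (s : 'S_n.+2) x0 y0 :
    (forall x, exists2 y, y != x & b y = b x) -> b x0 != b y0 ->
    respects b (zeta n) -> (forall x y, respects b (del y (del x s))) ->
  adj_perm s.
Proof.
move=> no_single nconst zb resp e e' ee'.
have ne : s e != s e' :> nat by rewrite val_eqE (inj_eq perm_inj) -val_eqE /= ee'; lia.
have [[lo hi _]|h] := adjacent_images no_single resp ee'.
  by move: lo hi; rewrite /cyc_adj; lia.
apply/negPn/negP => nadj; have ltu := ltn_ord (s e); have ltw := ltn_ord (s e').
(* Deleting a value outside the span of the two images keeps them at distance at least two. One of 0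
   and n + 1 is such a value, as the images are not both extreme. *)
have [v [vu vw vI]] : exists v : 'I_n.+2, [/\ v != s e, v != s e' &
    ~~ (minn (s e) (s e') < v < maxn (s e) (s e'))].
  have [lo0|lo0] := ltnP 0 (minn (s e) (s e')).
    by exists ord0; split; rewrite -?val_eqE /=; lia.
  by exists ord_max; split; move: nadj; rewrite /cyc_adj -?val_eqE /=; lia.
have [u0 eu _] := unlift_some vu; have [w0 ew _] := unlift_some vw.
have fc := h v u0 w0 (esym eu) (esym ew).
have far : (u0.+1 < w0) || (w0.+1 < u0).
  move: nadj vI vu vw; rewrite /cyc_adj -!val_eqE /=.
  by move/(congr1 val): eu; move/(congr1 val): ew; rewrite /= /bump; lia.
case/eqP: nconst; case/orP: far => far; first exact: cyc_fixed_const far fc _ _.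
by apply: cyc_fixed_const far _ _ _; rewrite // -cycV; apply: fixesV.
Qed.

(** * Permutations of length n + i with all n-patterns in Aut Pi *)

Section Main.
Variables (n : nat) (P : {set {set 'I_n}}).
Hypothesis parP : partition P [set: 'I_n].
Hypothesis two_blocks : 2 <= #|P|.
Hypothesis no_singleton : forall B : {set 'I_n}, B \in P -> #|B| <> 1%N.
Let b := pblock P.

Lemma partner x : exists2 y, y != x & b y = b x.
Proof.
have xB := pblock_self x parP; have := no_singleton (pblock_in x parP).
have [/eqP// |ne _] := boolP (#|pblock P x| == 1%N).
have : 1 < #|pblock P x|.
  by rewrite ltn_neqAle eq_sym ne (cardD1 x) xB.
rewrite (cardD1 x) xB ltnS => /card_gt0P[y]; rewrite !inE => /andP[yx].
by rewrite mem_pblockE // => /eqP bxy; exists y.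
Qed.

Lemma two_labels : exists x y, b x != b y.
Proof.
case/card_gt1P: two_blocks => B [C [BP CP BC]].
have inh D : D \in P -> exists x, b x = D.
  case/and3P: parP => _ tP P0 DP.
  have [x xD] : exists x, x \in D by apply/set0Pn; apply: contraTneq DP => ->.
  by exists x; apply: def_pblock.
have [x bx] := inh B BP; have [y by_] := inh C CP.
by exists x, y; rewrite bx by_.
Qed.

Lemma n_gt0 : 0 < n.
Proof. by have [x _] := two_labels; have := ltn_ord x; lia. Qed.

Lemma iter_derived_partition i : partition (iter_derived P i) [set: 'I_(i + n)].
Proof.
elim: i => [//|i IH]; apply: (@partition_derived (i + n)) => //.
by rewrite addn_gt0 n_gt0 orbT.
Qed.

Definition cuts i : pred nat := cut (pblock (iter_derived P i)).

Lemma cutsS i : cuts i.+1 =1 succ_cuts (cuts i).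
Proof.
apply: (@cut_derived (i + n)); last exact: iter_derived_partition.
by rewrite addn_gt0 n_gt0 orbT.
Qed.

Lemma cuts_exist i : exists c, cuts i c.
Proof.
elim: i => [|i [c ci]]; last by exists c; rewrite cutsS /succ_cuts ci.
have [x [y bxy]] := two_labels.
have [/existsP[c cc]|/existsPn nc] := boolP [exists c : 'I_n, cuts 0 c].
  by exists c.
case/eqP: bxy; apply: no_cut => c cc.
have cn : c < n by have := cut_range cc; lia.
by have /negP[] := nc (Ordinal cn).
Qed.

Lemma iter_stabP i s :
  reflect (keeps (cuts i.+1) s) (s \in partition_stab (iter_derived P i.+1)).
Proof.
have in0 : 0 < i + n by rewrite addn_gt0 n_gt0 orbT.
apply: (iffP (partition_stab_derived s in0 (iter_derived_partition i))).
- by move=> h c; rewrite cutsS; apply: h.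
- by move=> h c; rewrite -[succ_cuts _ c]cutsS; apply: h.
Qed.

Let CompA i := Comp (i + n) (partition_aut P).

Lemma CompAS i : CompA i.+1 = comp_succ (CompA i).
Proof. by apply: Comp_succ; apply: leq_addl. Qed.

(** This reduces containment of a generated subgroup to its generators. *)
Lemma group_set_CompA i : group_set (CompA i).
Proof.
elim: i => [|i IH]; first by rewrite /CompA Comp_id group_set_partition_aut.
by rewrite CompAS; apply: (group_set_comp_succ (Group IH)).
Qed.

Canonical CompA_group i := Group (group_set_CompA i).

Lemma CompA0 s : s \in CompA 0 -> respects b s.
Proof. by rewrite /CompA Comp_id => /partition_autP-/(_ parP). Qed.

Lemma keeps_CompA i s : keeps (cuts i) s -> s \in CompA i.
Proof.
elim: i s => [|i IH] s hs.
  rewrite /CompA Comp_id; apply/partition_autP => //.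
  exact/fixes_respects/keeps_cut_fixes.
rewrite CompAS; apply/comp_succP => x; apply: IH; apply: keeps_del => c.
by rewrite -cutsS; apply: hs.
Qed.

Lemma delta_CompA i : delta n \in partition_aut P -> delta (i + n) \in CompA i.
Proof.
move=> dA; elim: i => [|i IH]; first by rewrite /CompA Comp_id.
by rewrite CompAS; apply/comp_succP => x; rewrite del_delta.
Qed.

Lemma zeta_CompA i : zeta n \in partition_aut P -> zeta (i + n) \in CompA i.
Proof.
move=> zA; elim: i => [|i IH]; first by rewrite /CompA Comp_id.
rewrite CompAS; apply/comp_succP => x; rewrite del_zeta.
by case: ifP => // _; apply: group1.
Qed.

(** In length n + 2, [two_deletions] gives the alternative for each single deletion, and [step]
    lifts it to the permutation. Each further length repeats [step]. *)
Lemma CompA_keeps i (s : 'S_(i.+2 + n)) : zeta n \notin partition_aut P ->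
  s \in CompA i.+2 ->
  keeps (cuts i.+2) s \/
  delta n \in partition_aut P /\ keeps (cuts i.+2) (s * delta (i.+2 + n)).
Proof.
move=> zA; have ext j k (t : 'S_k) : keeps (succ_cuts (cuts j)) t <-> keeps (cuts j.+1) t.
  by split=> h c; [rewrite cutsS | rewrite -[succ_cuts _ c]cutsS]; apply: h.
have step j (t : 'S_(j.+2 + n)) :
    (forall x, keeps (cuts j.+1) (del x t) \/
       delta n \in partition_aut P /\ keeps (cuts j.+1) (del x t * delta (j.+1 + n))) ->
    keeps (cuts j.+2) t \/
    delta n \in partition_aut P /\ keeps (cuts j.+2) (t * delta (j.+2 + n)).
  have range c : cuts j.+1 c -> 0 < c < j.+1 + n by apply: cut_range.
  have [dA|dN] := boolP (delta n \in partition_aut P) => ht; last first.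
    by left; apply/ext/keeps_succ => // x; case: (ht x) => // -[].
  (* A cut c at level j yields the adjacent cuts c and c + 1 at level j + 1 that [keeps_succ_or]
     requires. *)
  have [c cj] := cuts_exist j; have c0 := cut_range cj.
  have cS : cuts j.+1 c by rewrite cutsS /succ_cuts cj.
  have cSS : cuts j.+1 c.+1 by rewrite cutsS /succ_cuts /= cj orbT.
  have ht' x : keeps (cuts j.+1) (del x t) \/ keeps (cuts j.+1) (del x t * delta (j.+1 + n)).
    by case: (ht x) => [|[]]; [left | right].
  have cpos : 0 < c by lia.
  have cj1 : c.+1 < j.+1 + n by rewrite addSn ltnS; case/andP: c0.
  have [/ext|/ext] := keeps_succ_or range cpos cj1 cS cSS ht'; by [left | right].
elim: i s => [|i IH] s; rewrite CompAS => /comp_succP sC; apply: step => x; last exact: IH.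
have [u v||h|[dA h]] := @two_deletions _ _ b s partner _ _ x.
- by apply: CompA0; have := sC u; rewrite CompAS => /comp_succP.
- by move=> zb; case/negP: zA; apply/partition_autP.
- by left; apply/ext.
- by right; split; [apply/partition_autP | apply/ext].
Qed.

Lemma CompA_adj i (s : 'S_(i.+2 + n)) : zeta n \in partition_aut P ->
  s \in CompA i.+2 -> adj_perm s.
Proof.
move=> /partition_autP-/(_ parP) zA; elim: i s => [|i IH] s.
  rewrite CompAS => /comp_succP sC; have [x0 [y0 ne]] := two_labels.
  apply: (two_deletions_adj partner ne zA) => u v; apply: CompA0.
  by have := sC u; rewrite CompAS => /comp_succP.
rewrite CompAS => /comp_succP sC; apply: (@adj_perm_succ (i.+2 + n)) => [|x]; last exact: IH.
(* A point and its partner give n >= 2, so i + 2 + n > 3. *)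
have [x0 _] := two_labels; have [y yx _] := partner x0.
have := ltn_ord x0; have := ltn_ord y; move: yx; rewrite -val_eqE /=; lia.
Qed.

End Main.

Local Close Scope group_scope.

Theorem theorem4p13 (n : nat) (P : {set {set 'I_n}})
    (partP : partition P [set: 'I_n])
    (two_blocks : 2 <= #|P|)
    (no_singleton : forall B : {set 'I_n}, B \in P -> #|B| <> 1)
    (i : nat) (i_ge2 : 2 <= i) :
  [/\ delta n \notin partition_aut P -> zeta n \notin partition_aut P ->
        Comp (i + n) (partition_aut P) = partition_stab (iter_derived P i),
      delta n \in partition_aut P -> zeta n \notin partition_aut P ->
        Comp (i + n) (partition_aut P)
        = <<partition_stab (iter_derived P i) :|: [set delta (i + n)]>>%g
    & zeta n \in partition_aut P ->
        Comp (i + n) (partition_aut P) = dihedral (i + n)].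
Proof.
case: i i_ge2 => [|[|i]] // _.
have sub s : s \in partition_stab (iter_derived P i.+2) ->
    s \in Comp (i.+2 + n) (partition_aut P).
  by move/(iter_stabP partP two_blocks); apply: keeps_CompA.
have upper := @CompA_keeps n P partP two_blocks no_singleton i.
split=> [dN zN|dA zN|zA]; apply/eqP; rewrite eqEsubset; apply/andP; split;
  apply/subsetP.
- move=> s /(upper s zN)[|[]]; last by rewrite (negPf dN).
  by move/(iter_stabP partP two_blocks).
- exact: sub.
- move=> s /(upper s zN)[|[_]] /(iter_stabP partP two_blocks) h.
    by apply: mem_gen; rewrite inE h.
  rewrite -(mulgK (delta (i.+2 + n)) s) groupM ?groupV //.
    by apply: mem_gen; rewrite inE h.
  by apply: mem_gen; rewrite !inE eqxx orbT.
- apply/subsetP; rewrite (gen_subG _ (CompA_group partP i.+2)).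
  apply/subsetP => s /setUP[/sub //|/set1P ->]; exact: delta_CompA.
- by move=> s sC; apply: adj_perm_dihedral; apply: CompA_adj sC.
apply/subsetP; rewrite (gen_subG _ (CompA_group partP i.+2)).
apply/subsetP => s /set2P[->|->]; first exact: zeta_CompA.
(* A partition preserved by the rotation is preserved by the reversal too. *)
apply: delta_CompA; apply/partition_autP => //; apply: respects_delta.
exact/partition_autP.
Qed.
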